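(* Let $u$ and $v$ be two quasi-definite moment functionals on $\Pi^d$, and let $\{\mathbb{P}_n\}_{n\ge0}$ and $\{\mathbb{Q}_n\}_{n\ge0}$ be the monic OPS associated with $u$ and $v$, respectively. The following statements are equivalent: (1) There exists a polynomial $\lambda(\mathbf{x})\in\Pi^d$ of exact (total) degree two such that $v=\lambda(\mathbf{x})\,u$. (2) For $n\ge1$, there exist real matrices $M_n$ of size $r_n^d\times r_{n-1}^d$ and $N_n$ of size $r_n^d\times r_{n-2}^d$, with $N_2\not\equiv0$, such that $$\mathbb{P}_n=\mathbb{Q}_n+M_n\mathbb{Q}_{n-1}+N_n\mathbb{Q}_{n-2},\qquad n\ge 1.$$
   Context: $\Pi^d$ is the space of real polynomials in $d$ variables, $\Pi^d_n$ the subspace of those of total degree at most $n$; $r_n^d=\binom{n+d-1}{n}$ is the number of monomials of total degree $n$. A moment functional is a linear functional $u:\Pi^d\to\mathbb{R}$, $p\mapsto\langle u,p\rangle$, acting entrywise on matrices of polynomials. For $\lambda\in\Pi^d$, $\lambda u$ is the functional $\langle\lambda u,p\rangle=\langle u,\lambda p\rangle$. Let $\mathbb{X}_n$ be the column vector of all monomials of total degree $n$ in a fixed (reverse lexicographical) order. A polynomial system (PS) is a sequence $\{\mathbb{P}_n\}_{n\ge0}$ of column vectors, $\mathbb{P}_n$ having $r_n^d$ entries which are polynomials of total degree $n$, such that for every $n$ the entries of $\mathbb{P}_0,\dots,\mathbb{P}_n$ form a basis of $\Pi_n^d$; it is monic if for all $n$ the entries of $\mathbb{P}_n-\mathbb{X}_n$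 have total degree at most $n-1$ (in particular $\mathbb{P}_0=1$). A PS is orthogonal with respect to $u$ (an OPS) if $\langle u,\mathbb{P}_m\mathbb{P}_n^t\rangle=0$ for $m\ne n$ and $H_n=\langle u,\mathbb{P}_n\mathbb{P}_n^t\rangle$ is invertible for all $n\ge0$. $u$ is quasi-definite if an OPS with respect to $u$ exists; then there is a unique monic OPS. Convention: $\mathbb{Q}_{-1}=0$, so the term with $N_1$ is absent when $n=1$. *)

(* Defs.v *)
From HB Require Import structures.
From mathcomp Require Import all_boot all_order all_algebra.
From mathcomp Require Import reals.
From mathcomp Require Import mpoly.

Set Implicit Arguments.
Unset Strict Implicit.
Unset Printing Implicit Defensive.

Import Order.TTheory GRing.Theory.

Local Open Scope ring_scope.

Definition nmon (d n : nat) : nat := 'C(n + d - 1, n).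

(* The order >=%O on 'X_{1..d} compares total degrees first and then the
   exponents lexicographically; in fixed degree n this lists x_1^n first and
   x_d^n last, e.g. x^2, xy, y^2 for d = n = 2. *)
Definition monoms (d n : nat) : seq 'X_{1..d} :=
  sort >=%O [seq bmnm m | m in [pred m : 'X_{1..d < n.+1} | mdeg m == n]].

Lemma mem_monoms (d n : nat) (m : 'X_{1..d}) :
  (m \in monoms d n) = (mdeg m == n).
Proof.
rewrite mem_sort; apply/imageP/idP => [[b + ->]|deg_m].
  by rewrite unfold_in.
have lt_m : (mdeg m < n.+1)%N by rewrite (eqP deg_m).
by exists (BMultinom lt_m) => //; rewrite unfold_in.
Qed.

Lemma uniq_monoms (d n : nat) : uniq (monoms d n).
Proof.
rewrite sort_uniq /image_mem map_inj_uniq ?enum_uniq //; exact: val_inj.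
Qed.

Lemma size_monoms (d n : nat) : size (monoms d n) == nmon d n.
Proof.
apply/eqP; case: d => [|d].
  have m0 (m : 'X_{1..0}) : m = 0%MM by apply/mnmP => -[].
  case: n => [|n].
    apply: (@perm_size _ _ [:: 0%MM]); apply: uniq_perm => // [|m].
      exact: uniq_monoms.
    by rewrite mem_monoms (m0 m) mdeg0 !inE !eqxx.
  rewrite /nmon addn0 subn1 bin_small //.
  apply: (@perm_size _ _ [::]); apply: uniq_perm => // [|m].
    exact: uniq_monoms.
  by rewrite mem_monoms (m0 m) mdeg0.
rewrite /nmon addnS subn1 /= -(size_basis d n); apply: perm_size.
apply: uniq_perm; [exact: uniq_monoms | exact: uniq_basis |] => m.
by rewrite mem_monoms -basis_cover.
Qed.

Definition monoms_tuple (d n : nat) : (nmon d n).-tuple 'X_{1..d} :=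
  Tuple (size_monoms d n).

Section Functionals.
Variables (R : realType) (d : nat).

(* [msize p] is the total degree plus one, and [msize 0 = 0]. *)
Definition mpoly_le (n : nat) : pred {mpoly R[d]} :=
  fun p => (msize p <= n.+1)%N.

Definition mulfun (lam : {mpoly R[d]}) (u : {scalar {mpoly R[d]}})
  (p : {mpoly R[d]}) : R := u (lam * p).

Lemma mulfun_is_scalar lam u : scalar (mulfun lam u).
Proof. by move=> a p q; rewrite /mulfun mulrDr -scalerAr linearP. Qed.

HB.instance Definition _ lam u :=
  GRing.isLinear.Build R {mpoly R[d]} R *%R (mulfun lam u)
    (mulfun_is_scalar lam u).

Definition cvmon (n : nat) : 'cV[{mpoly R[d]}]_(nmon d n) :=
  \col_i 'X_[tnth (monoms_tuple d n) i].

Implicit Type P : forall n, 'cV[{mpoly R[d]}]_(nmon d n).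

Definition lincomb P (n : nat) (c : forall k, 'I_(nmon d k) -> R) :
  {mpoly R[d]} := \sum_(k < n.+1) \sum_(i < nmon d k) c k i *: P k i ord0.

Definition basis_le P (n : nat) : Prop :=
  [/\ forall k i, (k <= n)%N -> mpoly_le n (P k i ord0),
      forall c, lincomb P n c = 0 ->
        forall k i, (k <= n)%N -> c k i = 0
    & forall p, mpoly_le n p -> exists c, p = lincomb P n c].

Definition poly_system P : Prop :=
  (forall n i, msize (P n i ord0) = n.+1) /\ (forall n, basis_le P n).

(* Total degree at most n - 1 is size at most n; for n = 0 this forces the
   difference to vanish, i.e. P_0 = 1. *)
Definition monic_system P : Prop :=
  forall n i, (msize ((P n - cvmon n) i ord0) <= n)%N.

Definition is_OPS (u : {scalar {mpoly R[d]}}) P : Prop :=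
  [/\ poly_system P,
      forall m n : nat, m != n -> map_mx u (P m *m (P n)^T) = 0
    & forall n, map_mx u (P n *m (P n)^T) \in unitmx].

Definition monic_OPS (u : {scalar {mpoly R[d]}}) P : Prop :=
  is_OPS u P /\ monic_system P.

Definition quasi_definite (u : {scalar {mpoly R[d]}}) : Prop :=
  exists P, is_OPS u P.

Definition mxC (m n : nat) (A : 'M[R]_(m, n)) : 'M[{mpoly R[d]}]_(m, n) :=
  map_mx (@mpolyC d R) A.

End Functionals.

Arguments mxC {R d m n} A.
Arguments cvmon R d n : clear implicits.

(* Main.v *)
(* Both directions rest on Fourier coefficients: a polynomial p of degree at
   most n whose coefficients u(p P_n) vanish has degree at most n - 1, because
   H_n is invertible.  If v = lambda u, then v(P_n Q_k) = u(P_n (lambda Q_k))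
   vanishes for k < n - 2, so only three terms of the expansion of P_n in the
   Q_k survive.  Conversely, the three-term relation makes v vanish on P_n for
   n >= 3, so v is represented by the polynomial lambda of degree at most two
   with u(lambda P_k) = v(P_k) for k <= 2.  In both directions N_2 is, up to
   an invertible factor, the degree-two Fourier coefficient of lambda. *)
Require Import Defs.
From HB Require Import structures.
From mathcomp Require Import all_boot all_order all_algebra.
From mathcomp Require Import reals.
From mathcomp Require Import mpoly.

Local Open Scope ring_scope.

Import GRing.Theory.

Lemma map_mx_mxC {R : realType} {d : nat} (u : {scalar {mpoly R[d]}})
  {m n q : nat} (A : 'M[R]_(m, n)) (B : 'M[{mpoly R[d]}]_(n, q)) :
  map_mx u (mxC A *m B) = A *m map_mx u B.
Proof.
apply/matrixP => i j; rewrite !mxE linear_sum; apply: eq_bigr => k _.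
by rewrite !mxE mul_mpolyC linearZ.
Qed.

Lemma mxC_mulE {R : realType} {d m n q : nat} (A : 'M[R]_(m, n))
  (B : 'M[{mpoly R[d]}]_(n, q)) i j :
  (mxC A *m B) i j = \sum_k A i k *: B k j.
Proof. by rewrite !mxE; apply: eq_bigr => k _; rewrite !mxE mul_mpolyC. Qed.

Lemma msize_sum_le {R : realType} {d n : nat} {I : finType}
  (F : I -> {mpoly R[d]}) :
  (forall i, (msize (F i) <= n)%N) -> (msize (\sum_i F i) <= n)%N.
Proof.
by move=> le_F; apply: leq_trans (msize_sum _ _ _) _; apply/bigmax_leqP => i _.
Qed.

(** * Fourier expansion in a single orthogonal system *)

Section OPS.
Set Implicit Arguments.
Unset Strict Implicit.
Variables (R : realType) (d : nat) (u : {scalar {mpoly R[d]}}).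
Variable P : forall n : nat, 'cV[{mpoly R[d]}]_(nmon d n).
Hypothesis opsP : is_OPS u P.

Let H n := map_mx u (P n *m (P n)^T).

Lemma OPS_gramE m n i j :
  map_mx u (P m *m (P n)^T) i j = u (P m i ord0 * P n j ord0).
Proof. by rewrite !mxE big_ord1 !mxE. Qed.

Lemma OPS_orth m n i j : m != n -> u (P m i ord0 * P n j ord0) = 0.
Proof. by case: opsP => _ + _ => /[apply] Puv; rewrite -OPS_gramE Puv mxE. Qed.

Lemma OPS_unitmx n : H n \in unitmx.
Proof. by case: opsP => _ _; apply. Qed.

Lemma OPS_msize n i : msize (P n i ord0) = n.+1.
Proof. by case: opsP => -[]. Qed.

Lemma OPS_span n (p : {mpoly R[d]}) :
  (msize p <= n.+1)%N -> exists c, p = lincomb P n c.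
Proof. by case: opsP => -[_ /(_ n)[_ _ +] _ _]; apply. Qed.

Lemma OPS_msize_lincomb n c : (msize (lincomb P n c) <= n.+1)%N.
Proof.
apply: msize_sum_le => k; apply: msize_sum_le => i.
by apply: leq_trans (msizeZ_le _ _) _; rewrite OPS_msize.
Qed.

(** Orthogonality leaves only the block of degree k, on which the Gram matrix [H k] acts from the
    right; for k > n there is no such block. *)
Lemma OPS_fourier n c k j :
  u (lincomb P n c * P k j ord0) =
  if (k <= n)%N then \sum_i c k i * H k i j else 0.
Proof.
rewrite mulr_suml linear_sum.
under eq_bigr => l _ do rewrite mulr_suml linear_sum.
under eq_bigr => l _ do
  under eq_bigr => i _ do rewrite -scalerAl linearZ.
rewrite /=.
have zero l : l != k -> \sum_i c l i * u (P l i ord0 * P k j ord0) = 0.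
  by move=> lk; rewrite big1 // => i _; rewrite OPS_orth // mulr0.
case: leqP => [le_kn|lt_nk]; last first.
  by rewrite big1 // => l _; apply: zero; rewrite neq_ltn (leq_trans (ltn_ord l)).
rewrite (bigD1 (Ordinal (le_kn : (k < n.+1)%N))) //= [X in _ + X]big1 ?addr0.
  by apply: eq_bigr => i _; rewrite /H OPS_gramE.
by move=> l lk; apply: zero.
Qed.

Lemma OPS_orth_lower n k (p : {mpoly R[d]}) j :
  (msize p <= n)%N -> (n <= k)%N -> u (p * P k j ord0) = 0.
Proof.
case: n => [|n].
  by rewrite leqn0 msize_poly_eq0 => /eqP-> _; rewrite mul0r linear0.
by move=> /OPS_span[c ->] lt_nk; rewrite OPS_fourier leqNgt lt_nk.
Qed.

Lemma OPS_msize_drop n (p : {mpoly R[d]}) : (msize p <= n.+1)%N ->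
  (forall j, u (p * P n j ord0) = 0) -> (msize p <= n)%N.
Proof.
move=> /OPS_span[c ->] p0.
have cn0 i : c n i = 0.
  (* The top coefficients, as a row, satisfy r H_n = 0, so the invertibility of H_n kills them. *)
  pose r := \row_i c n i.
  have rH : r *m H n = 0.
    apply/rowP => j; rewrite [RHS]mxE -(p0 j) OPS_fourier leqnn mxE.
    by apply: eq_bigr => l _; rewrite [r _ _]mxE.
  have Hu := OPS_unitmx n.
  by have := mulmxK Hu r; rewrite rH mul0mx => /rowP/(_ i); rewrite !mxE.
rewrite /lincomb big_ord_recr /= [X in _ + X]big1 ?addr0; last first.
  by move=> i _; rewrite cn0 scale0r.
apply: msize_sum_le => k; apply: msize_sum_le => i.
by apply: leq_trans (msizeZ_le _ _) _; rewrite OPS_msize.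
Qed.

(** The degree drops one step at a time until size 0, which only the zero polynomial has. *)
Lemma OPS_orth_eq0 n (p : {mpoly R[d]}) : (msize p <= n)%N ->
  (forall k j, (k < n)%N -> u (p * P k j ord0) = 0) -> p = 0.
Proof.
elim: n => [|n IHn] le_p p0.
  by apply/eqP; rewrite -msize_poly_eq0 -leqn0.
apply: IHn => [|k j lt_kn]; last by rewrite p0 // ltnW.
by apply: OPS_msize_drop => // j; apply: p0.
Qed.

Lemma OPS_interpolate (b : forall k, 'I_(nmon d k) -> R) n :
  exists2 p : {mpoly R[d]}, (msize p <= n.+1)%N &
    forall k j, u (p * P k j ord0) = if (k <= n)%N then b k j else 0.
Proof.
(* Each degree is solved separately: the coefficient row c_k must satisfy c_k H_k = b_k. *)
pose c k := \row_j b k j *m invmx (H k).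
exists (lincomb P n (fun k i => c k ord0 i)); first exact: OPS_msize_lincomb.
move=> k j; rewrite OPS_fourier; case: ifP => // _.
have Hu := OPS_unitmx k.
by have /rowP/(_ j) := mulmxKV Hu (\row_j b k j); rewrite !mxE.
Qed.

Lemma eq_on_OPS (v w : {scalar {mpoly R[d]}}) :
  (forall k j, v (P k j ord0) = w (P k j ord0)) -> v =1 w.
Proof.
(* The bound [msize p] exceeds the degree by one; this slack also covers p = 0. *)
move=> vw p; have [c ->] := @OPS_span (msize p) p (leqnSn _).
rewrite !linear_sum; apply: eq_bigr => k _.
rewrite !linear_sum; apply: eq_bigr => i _.
by rewrite !linearZ /= vw.
Qed.

Lemma OPS_head_const (j : 'I_(nmon d 0)) :
  exists2 a : R, a != 0 & P 0 j ord0 = a%:MP.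
Proof.
have /eqP/msize_poly1P[a a0 ->] := OPS_msize j.
by exists a.
Qed.

(* Multiplying by the constant polynomial P_0 on the right keeps matrix
   identities usable without identifying [nmon d 0] with [1]. *)
Lemma OPS_head_eq0 (v : {scalar {mpoly R[d]}}) n
  (B : 'cV[{mpoly R[d]}]_n) :
  (map_mx v (B *m (P 0)^T) = 0) <-> (forall i, v (B i ord0) = 0).
Proof.
have entry i j a : P 0 j ord0 = a%:MP ->
    map_mx v (B *m (P 0)^T) i j = a * v (B i ord0).
  by move=> P0; rewrite !mxE big_ord1 !mxE P0 mulrC mul_mpolyC linearZ.
split=> [B0 i|B0]; last first.
  apply/matrixP => i j; have [a _ P0] := OPS_head_const j.
  by rewrite (entry _ _ _ P0) B0 mulr0 mxE.
have lt0 : (0 < nmon d 0)%N by rewrite /nmon bin0.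
have [a a0 P0] := OPS_head_const (Ordinal lt0).
have := entry i _ _ P0; rewrite B0 mxE => /esym/eqP.
by rewrite mulf_eq0 (negPf a0) => /eqP.
Qed.

End OPS.

(** * Connection coefficients between two orthogonal systems *)

Section TwoSystems.
Set Implicit Arguments.
Unset Strict Implicit.
Variables (R : realType) (d : nat) (u v : {scalar {mpoly R[d]}}).
Variables P Q : forall n : nat, 'cV[{mpoly R[d]}]_(nmon d n).
Hypotheses (opsP : is_OPS u P) (opsQ : is_OPS v Q).

Lemma monic_systems_sub n i : monic_system P -> monic_system Q ->
  (msize (P n i ord0 - Q n i ord0) <= n)%N.
Proof.
move=> /(_ n i) monP /(_ n i) monQ.
have -> : P n i ord0 - Q n i ord0 =
    (P n - cvmon R d n) i ord0 - (Q n - cvmon R d n) i ord0.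
  by rewrite !mxE opprB addrA subrK.
by apply: leq_trans (msizeD_le _ _) _; rewrite msizeN geq_max monP.
Qed.

(** The block of Fourier coefficients of P_n along Q_k with respect to v. *)
Definition connection_mx (n k : nat) : 'M[R]_(nmon d n, nmon d k) :=
  map_mx v (P n *m (Q k)^T) *m invmx (map_mx v (Q k *m (Q k)^T)).

Lemma connection_mx_fourier n k l i j :
  v ((mxC (connection_mx n k) *m Q k) i ord0 * Q l j ord0) =
  if k == l then v (P n i ord0 * Q l j ord0) else 0.
Proof.
set A := connection_mx n k.
have -> : v ((mxC A *m Q k) i ord0 * Q l j ord0) =
    (A *m map_mx v (Q k *m (Q l)^T)) i j.
  rewrite -map_mx_mxC mulmxA [RHS]mxE; congr (v _).
  by rewrite [RHS]mxE big_ord1 [_^T _ _]mxE.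
case: (opsQ) => _ Qorth Qunit; case: eqVneq => [kl|kl]; last first.
  by rewrite Qorth // mulmx0 mxE.
(* The type of [j] depends on [l], so the equality is eliminated rather than rewritten; the inverse
   Gram matrix then cancels. *)
by case: _ / kl j => j; rewrite mulmxKV ?Qunit // !mxE big_ord1 !mxE.
Qed.

Lemma msize_mxC_mul n k (A : 'M[R]_(n, nmon d k)) i :
  (msize ((mxC A *m Q k) i ord0) <= k.+1)%N.
Proof.
rewrite mxC_mulE; apply: msize_sum_le => j.
by apply: leq_trans (msizeZ_le _ _) _; rewrite (OPS_msize opsQ).
Qed.

Lemma connection_three_term lam n : monic_system P -> monic_system Q ->
  (msize lam <= 3)%N -> v =1 mulfun lam u -> (1 <= n)%N ->
  P n = Q n + mxC (connection_mx n (n - 1)) *m Q (n - 1)%N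
        + (if (2 <= n)%N
           then mxC (connection_mx n (n - 2)) *m Q (n - 2)%N else 0).
Proof.
move=> monP monQ le_lam vu n_gt0; apply/matrixP => i z.
have {z}-> : z = ord0 by exact: ord1.
rewrite [RHS]mxE [X in X + _]mxE; apply/eqP; rewrite -subr_eq0 opprD opprD !addrA.
set Y := (X in _ - X); set X := (X in _ - X - Y).
(* The monic leading parts cancel, so the difference of the two sides has degree below n, and it
   suffices that its v-Fourier coefficients along Q_k vanish for k < n. *)
apply/eqP; apply: (OPS_orth_eq0 opsQ (n := n)).
  apply: leq_trans (msizeD_le _ _) _; rewrite msizeN geq_max; apply/andP; split.
    apply: leq_trans (msizeD_le _ _) _; rewrite msizeN geq_max.
    rewrite monic_systems_sub //=.
    by apply: leq_trans (msize_mxC_mul _ _) _; rewrite subn1 prednK.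
  rewrite /Y; case: ifP => [n_gt1|_]; last by rewrite mxE msize0.
  by apply: leq_trans (msize_mxC_mul _ _) _; rewrite subn2; case: (n) n_gt1 => [|[]].
move=> k j lt_kn.
rewrite !mulrBl !linearB /= (OPS_orth opsQ) ?gtn_eqF // subr0.
rewrite connection_mx_fourier.
(* The guard matters at n = 1, where the truncated n - 2 equals n - 1 = 0. *)
have -> : v (Y * Q k j ord0) =
    if (2 <= n)%N && (n - 2 == k)%N then v (P n i ord0 * Q k j ord0) else 0.
  rewrite /Y; case: ifP => _ /=; last by rewrite mxE mul0r linear0.
  by rewrite connection_mx_fourier.
case: eqVneq => [nk|n1k].
  have /negPf-> : ~~ ((1 < n)%N && (n - 2 == k)%N).
    by apply/negP => /andP[n_gt1 /eqP nk2]; move: nk; rewrite -nk2;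
       case: (n) n_gt1 => [|[|m]] // _; rewrite !subSS !subn0 => /eqP;
       rewrite gtn_eqF.
  by rewrite !subr0 subrr.
case: ifPn => [_|n2k]; first by rewrite subr0 subrr.
(* For k < n - 2 only v(P_n Q_k) = u(lam Q_k P_n) is left, and lam Q_k has degree at most k + 2 <
   n. *)
rewrite !subr0 vu /mulfun mulrCA mulrC.
apply: (OPS_orth_lower opsP (n := k.+3)).
  (* The size formula for products needs nonzero factors. *)
  case: (eqVneq lam 0) => [->|lam0]; first by rewrite mul0r msize0.
  have Q0 : Q k j ord0 != 0 by rewrite -msize_poly_eq0 (OPS_msize opsQ).
  by rewrite msizeM // (OPS_msize opsQ) addnS /= (leq_add2r k _ 3).
(* It remains to see k + 3 <= n, since k < n differs from n - 1 and n - 2. *)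
move: n2k n1k lt_kn n_gt0; case: (n) => [|[|m]] //=.
  by case: (k).
rewrite !subSS !subn0 ltnS => mk m1k.
by rewrite leq_eqVlt eq_sym (negPf m1k) ltnS /= leq_eqVlt eq_sym (negPf mk).
Qed.

(** Otherwise v(P_2) = u(lam P_2) would vanish, and lam would lose its degree-two part. *)
Lemma connection_mx_neq0 lam : msize lam = 3%N -> v =1 mulfun lam u ->
  connection_mx 2 0 <> 0.
Proof.
move=> sz_lam vu N0.
have := mulmxKV (OPS_unitmx opsQ 0) (map_mx v (P 2 *m (Q 0)^T)).
rewrite -/(connection_mx 2 0) N0 mul0mx => /esym/(OPS_head_eq0 opsQ) vP2.
suff: (msize lam <= 2)%N by rewrite sz_lam.
apply: (OPS_msize_drop opsP); first by rewrite sz_lam.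
by move=> j; rewrite -[LHS](vu (P 2 j ord0)) vP2.
Qed.

Lemma three_term_mulfun (M : forall n : nat, 'M[R]_(nmon d n, nmon d (n - 1)))
    (N : forall n : nat, 'M[R]_(nmon d n, nmon d (n - 2))) :
  N 2 <> 0 ->
  (forall n : nat, (1 <= n)%N ->
     P n = Q n + mxC (M n) *m Q (n - 1)%N
           + (if (2 <= n)%N then mxC (N n) *m Q (n - 2)%N else 0)) ->
  exists lam : {mpoly R[d]}, msize lam = 3%N /\ v =1 mulfun lam u.
Proof.
move=> N2 PQ.
(* v(Q_k) pairs Q_k with the constant 1, of degree below k. *)
have vQ k j : (0 < k)%N -> v (Q k j ord0) = 0.
  move=> k_gt0; rewrite -[Q k j ord0]mul1r.
  by apply: (OPS_orth_lower opsQ (n := 1%N)); rewrite ?msize1.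
have vmx k : (0 < k)%N -> map_mx v (Q k) = 0.
  by move=> k_gt0; apply/colP => i; rewrite !mxE vQ.
have vP n j : (2 < n)%N -> v (P n j ord0) = 0.
  move=> n_gt2; suff /colP/(_ j) : map_mx v (P n) = 0 by rewrite !mxE.
  have n_gt1 := ltnW n_gt2.
  rewrite (PQ n (ltnW n_gt1)) n_gt1 !map_mxD !map_mx_mxC.
  by rewrite !vmx ?subn_gt0 ?(ltnW n_gt1) // !mulmx0 !addr0.
have [lam le_lam lamP] := OPS_interpolate opsP (fun k j => v (P k j ord0)) 2.
have vu : v =1 mulfun lam u.
  apply: (eq_on_OPS opsP) => k j; rewrite [RHS]lamP.
  by case: leqP => k2 //; rewrite vP.
exists lam; split=> //; apply/eqP; rewrite eqn_leq le_lam ltnNge.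
(* If lam had degree at most one, then v(P_2) = u(lam P_2) = 0; but the relation at n = 2 gives
   v(P_2 Q_0^t) = N_2 v(Q_0 Q_0^t), so N_2 would be 0. *)
apply/negP => lam2; apply: N2.
have /(OPS_head_eq0 opsQ) : forall i, v (P 2 i ord0) = 0.
  by move=> i; rewrite vu; apply: (OPS_orth_lower opsP _ lam2).
case: (opsQ) => _ Qorth _.
rewrite PQ // !mulmxDl -!mulmxA !map_mxD !map_mx_mxC /=.
rewrite (Qorth 2%N 0%N) // (Qorth (2 - 1)%N 0%N) // mulmx0 !add0r => N2H.
by have := mulmxK (OPS_unitmx opsQ 0) (N 2); rewrite N2H mul0mx.
Qed.

End TwoSystems.

Theorem theorem4p1 (R : realType) (d : nat) (u v : {scalar {mpoly R[d]}})
  (hu : quasi_definite u) (hv : quasi_definite v)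
  (P Q : forall n : nat, 'cV[{mpoly R[d]}]_(nmon d n))
  (hP : monic_OPS u P) (hQ : monic_OPS v Q) :
  (exists lam : {mpoly R[d]}, msize lam = 3%N /\ v =1 mulfun lam u)
  <->
  (exists (M : forall n : nat, 'M[R]_(nmon d n, nmon d (n - 1)))
          (N : forall n : nat, 'M[R]_(nmon d n, nmon d (n - 2))),
     N 2%N <> 0 /\
     forall n : nat, (1 <= n)%N ->
       P n = Q n + mxC (M n) *m Q (n - 1)%N
             + (if (2 <= n)%N then mxC (N n) *m Q (n - 2)%N else 0)).
Proof.
case: hP hQ => opsP monP [opsQ monQ]; split=> [[lam [sz_lam vu]]|].
  exists (fun n => connection_mx v P Q n (n - 1)).
  exists (fun n => connection_mx v P Q n (n - 2)); split.
    exact: connection_mx_neq0 sz_lam vu.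
  by move=> n; apply: (connection_three_term opsP opsQ) vu; rewrite ?sz_lam.
by case=> M [N [N2 PQ]]; apply: three_term_mulfun N2 PQ.
Qed.
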